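(* $\mathsf{MS4}$ is canonical; that is, if $\mathfrak B$ is an $\mathsf{MS4}$-algebra, then $(\mathfrak B_+)^+$ is an $\mathsf{MS4}$-algebra.
   Context: An interior operator on a boolean algebra $B$ is a map $\mathsf i:B\to B$ with $\mathsf i(a\wedge b)=\mathsf ia\wedge\mathsf ib$, $\mathsf i1=1$, $\mathsf ia\le a$, $\mathsf ia\le\mathsf{ii}a$. An $\mathsf{MS4}$-algebra is a tuple $\mathfrak B=(B,\Box,\forall)$ where $B$ is a boolean algebra, $\Box,\forall$ are interior operators on $B$, and for all $a\in B$: $a\le\forall\exists a$ (where $\exists:=\neg\forall\neg$) and $\Box\forall a\le\forall\Box a$. The canonical frame of $\mathfrak B$ is $\mathfrak B_+=(X_{\mathfrak B},R_{\mathfrak B},E_{\mathfrak B})$, where $X_{\mathfrak B}$ is the set of ultrafilters of $B$; $xR_{\mathfrak B}y$ iff $x\cap H\subseteq y$, with $H=\{a\in B\mid\Box a=a\}$; and $xE_{\mathfrak B}y$ iff $x\cap B_0=y\cap B_0$, with $B_0=\{a\in B\mid\forall a=a\}$. For a frame $\mathfrak F=(X,R,E)$ with $R$ a quasi-order and $E$ an equivalence relation on $X$, $\mathfrak F^+=(\wp(X),\Box_R,\forall_E)$, where $\Box_R(U)=X\setminus R^{-1}[X\setminus U]$ and $\forall_E(U)=X\setminus E[X\setminus U]$; here $R^{-1}[U]=\{x\mid xRu\text{ for some }u\in U\}$ and $E[U]=\{x\mid uEx\text{ for some }u\in U\}$. *)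

(* Defs.v *)
From Corelib Require Import RelationClasses.
From HB Require Import structures.
From mathcomp Require Import all_boot all_order.
From mathcomp Require Import boolp classical_sets.

Set Implicit Arguments.
Unset Strict Implicit.
Unset Printing Implicit Defensive.

Local Open Scope order_scope.

(** Boolean algebras are [ctbDistrLatticeType]s (the trivial one, where
    [\bot = \top], is included). *)

Definition interior_operator (d : Order.disp_t) (B : ctbDistrLatticeType d)
    (i : B -> B) : Prop :=
  [/\ forall a b, i (a `&` b) = i a `&` i b,
      i \top = \top,
      forall a, i a <= a
    & forall a, i a <= i (i a)].

(** The signature of MS4-algebras; the axioms are [MS4_algebra] below. *)
Record bimodal_algebra (d : Order.disp_t) := BimodalAlgebra {
  alg_carrier :> ctbDistrLatticeType d;
  alg_box : alg_carrier -> alg_carrier;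
  alg_forall : alg_carrier -> alg_carrier }.

Definition alg_exists (d : Order.disp_t) (A : bimodal_algebra d) (a : A) : A :=
  ~` alg_forall (~` a).

Definition MS4_algebra (d : Order.disp_t) (A : bimodal_algebra d) : Prop :=
  [/\ interior_operator (@alg_box d A),
      interior_operator (@alg_forall d A),
      forall a : A, a <= alg_forall (alg_exists a)
    & forall a : A, alg_box (alg_forall a) <= alg_forall (alg_box a)].

Record frame := Frame {
  frame_carrier :> Type;
  frame_R : frame_carrier -> frame_carrier -> Prop;
  frame_E : frame_carrier -> frame_carrier -> Prop;
  frame_R_preorder : PreOrder frame_R;
  frame_E_equivalence : Equivalence frame_E }.

Section Ultrafilters.
Context (d : Order.disp_t) (B : ctbDistrLatticeType d).

Definition lattice_filter (F : set B) : Prop :=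
  [/\ F \top,
      forall a b, F a -> F b -> F (a `&` b)
    & forall a b, a <= b -> F a -> F b].

Definition proper_filter (F : set B) : Prop :=
  lattice_filter F /\ ~ F \bot.

Definition ultrafilter (F : set B) : Prop :=
  proper_filter F /\
  forall G : set B, proper_filter G -> (F `<=` G)%classic -> G = F.

End Ultrafilters.

Section CanonicalFrame.
Context (d : Order.disp_t) (A : bimodal_algebra d).
Local Open Scope classical_set_scope.

Definition ultrafilters : Type := {x : set A | ultrafilter x}.

Definition canonical_R (x y : ultrafilters) : Prop :=
  sval x `&` [set a : A | alg_box a = a] `<=` sval y.

Definition canonical_E (x y : ultrafilters) : Prop :=
  sval x `&` [set a : A | alg_forall a = a] =
  sval y `&` [set a : A | alg_forall a = a].

Lemma canonical_R_preorder : PreOrder canonical_R.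
Proof.
split; first by move=> x a [].
by move=> x y z xy yz a [xa Ha]; apply: yz; split=> //; apply: xy.
Qed.

Lemma canonical_E_equivalence : Equivalence canonical_E.
Proof. by split=> [x|x y|x y z]; rewrite /canonical_E // => -> ->. Qed.

Definition canonical_frame : frame :=
  Frame canonical_R_preorder canonical_E_equivalence.

End CanonicalFrame.

Section ComplexAlgebra.
Context (F : frame).
Local Open Scope classical_set_scope.

Definition frame_R_preimage (U : set F) : set F :=
  [set x | exists2 u, U u & frame_R x u].

Definition frame_E_image (U : set F) : set F :=
  [set x | exists2 u, U u & frame_E u x].

Definition frame_box (U : set F) : set F := ~` frame_R_preimage (~` U).

Definition frame_forall (U : set F) : set F := ~` frame_E_image (~` U).

(** The boolean algebra structure on [set F] is the canonical powerset one,
    ordered by inclusion. *)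
Definition complex_algebra : bimodal_algebra _ :=
  @BimodalAlgebra _ (set F) frame_box frame_forall.

End ComplexAlgebra.

(* Main.v *)
Require Import Defs.
From mathcomp Require Import all_boot all_order.
From mathcomp Require Import boolp classical_sets.

(** Among complex algebras of frames [(X, R, E)], all the MS4 axioms except
    [box (forall a) <= forall (box a)] only use that [R] is a preorder and [E]
    an equivalence relation.  That last axiom follows from the commutation
    condition: if [x E y] and [y R z], then [x R w] and [w E z] for some [w].

    The point is thus to find such an ultrafilter [w] in the canonical frame
    of an MS4-algebra.  Let [S] be the set of box-fixed elements of [x] and
    [T] the set of forall-fixed elements of [z].  Both are closed under finite
    meets, so they generate a filter, and this filter is proper: if [h] in [S]
    and [b] in [T] had meet [\bot], then [h <= ~` b], and since [~` b] is again
    forall-fixed, [h = box h <= box (~` b) = box (forall (~` b))], which lies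
    below the forall-fixed element [c := forall (box (~` b))].  Hence [c]
    belongs to [x], then to [y] because [x E y].  As [c <= box (~` b)], the
    box-fixed element [box (~` b)] is in [y], hence in [z] because [y R z], so
    that [z] contains both [b] and [~` b].  By Zorn's lemma the filter extends
    to an ultrafilter [w].  It contains [S], so [x R w], and it contains [T];
    since the forall-fixed elements are closed under complement, [w] and [z]
    then have the same forall-fixed elements. *)

Set Implicit Arguments.
Unset Strict Implicit.
Unset Printing Implicit Defensive.

Import Order.Theory.

Local Open Scope order_scope.

Section Filters.
Context (d : Order.disp_t) (B : ctbDistrLatticeType d).
Implicit Types (F G S T U : set B) (a b c : B).

(** Closure under finite meets, the empty meet [\top] included. *)
Definition meet_closed S : Prop :=
  S \top /\ forall a b, S a -> S b -> S (a `&` b).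

(** The filter generated by the union of [S] and [T], when both are
    [meet_closed]. *)
Definition filter_join S T : set B :=
  [set c | exists a b, [/\ S a, T b & (a `&` b <= c)%O]]%classic.

Lemma filter_meet_closed F : lattice_filter F -> meet_closed F.
Proof. by case. Qed.

Lemma filter_join_filter S T :
  meet_closed S -> meet_closed T -> lattice_filter (filter_join S T).
Proof.
move=> [S1 SI] [T1 TI]; split.
- by exists \top, \top; split; rewrite // lex1.
- move=> c c' [a [b [Sa Tb le_c]]] [a' [b' [Sa' Tb' le_c']]].
  exists (a `&` a'), (b `&` b'); split; [exact: SI|exact: TI|].
  by rewrite meetACA leI2.
- move=> c c' cc' [a [b [Sa Tb le_c]]].
  by exists a, b; split=> //; exact: le_trans cc'.
Qed.

Lemma filter_join_proper S T : meet_closed S -> meet_closed T ->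
  (forall a b, S a -> T b -> ~ a <= ~` b) -> proper_filter (filter_join S T).
Proof.
move=> mS mT ST; split; first exact: filter_join_filter.
by move=> [a [b [Sa Tb]]]; rewrite lex0 disj_leC; exact: ST.
Qed.

Lemma filter_join_subl S T : meet_closed T -> (S `<=` filter_join S T)%classic.
Proof. by move=> [T1 _] a Sa; exists a, \top; split; rewrite // leIl. Qed.

Lemma filter_join_subr S T : meet_closed S -> (T `<=` filter_join S T)%classic.
Proof. by move=> [S1 _] b Tb; exists \top, b; split; rewrite // leIr. Qed.

Lemma ultrafilter_compl U a : ultrafilter U -> U (~` a) <-> ~ U a.
Proof.
move=> [[fU U0] maxU]; have [U1 UI Ule] := fU; split=> [Una Ua|nUa].
  by apply: U0; rewrite -(meetxC a); exact: UI.
(* By maximality [U] equals the filter generated by [U] and [~` a], which is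
   proper because no [b] in [U] lies below [a]. *)
have mU := filter_meet_closed fU.
have mT : meet_closed [set b | (~` a <= b)%O]%classic.
  by split=> [|b c /= ab ac]; rewrite /= ?lex1 // lexI ab.
rewrite -(maxU (filter_join U [set b | (~` a <= b)%O]%classic)).
- by apply: filter_join_subr => /=.
- apply: filter_join_proper => // b c Ub /= ac bc.
  by apply/nUa/(Ule b) => //; rewrite -[a]complK (le_trans bc) ?leC.
- exact: filter_join_subl.
Qed.

Lemma proper_filter_bigcup_chain F (C : set (set B)) :
  proper_filter F -> (C `<=` [set X | proper_filter (X `|` F)])%classic ->
  total_on C subset -> proper_filter (\bigcup_(X in C) X `|` F)%classic.
Proof.
move=> pF; set V := (_ `|` F)%classic => CP totC.
have [[F1 _ _] _] := pF.
(* Two elements of the union [V] always lie in a common proper filter contained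
   in [V], which is all that the filter axioms for [V] require. *)
have outV a b : V a -> V b ->
    exists2 G, proper_filter G /\ (G `<=` V)%classic & G a /\ G b.
  have pX (X : set B) : C X ->
      proper_filter (X `|` F)%classic /\ (X `|` F `<=` V)%classic.
    move=> CX; split; first exact: CP.
    by move=> a' [Xa|Fa]; [left; exists X|right].
  move=> [[X CX Xa]|Fa] [[Y CY Yb]|Fb].
  - have [XY|YX] := totC _ _ CX CY.
      by exists (Y `|` F)%classic; [exact: pX|split; left; first exact: XY].
    by exists (X `|` F)%classic; [exact: pX|split; left; last exact: YX].
  - by exists (X `|` F)%classic; [exact: pX|split; [left|right]].
  - by exists (Y `|` F)%classic; [exact: pX|split; [right|left]].
  - by exists F => //; split=> // c; right.
split; first split.
- by right.
- move=> a b Va Vb; have [G [[[_ GI _] _] GV] [Ga Gb]] := outV _ _ Va Vb.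
  exact/GV/GI.
- move=> a b ab Va; have [G [[[_ _ Gle] _] GV] [Ga _]] := outV _ _ Va Va.
  exact/GV/(Gle a).
- by move=> V0; have [G [[_ G0] _] [/G0]] := outV _ _ V0 V0.
Qed.

Lemma ultrafilter_extension F : proper_filter F ->
  exists2 U, ultrafilter U & (F `<=` U)%classic.
Proof.
move=> pF.
(* Joining [F] to each set makes the empty chain harmless: its union, the empty
   set, satisfies the predicate to which Zorn's lemma is applied. *)
have [A [pA maxA]] := @Zorn_bigcup _ [set X | proper_filter (X `|` F)%classic]
  (fun C => @proper_filter_bigcup_chain F C pF).
exists (A `|` F)%classic => [|a]; last by right.
split=> // G pG AFG.
have AG : (A `<=` G)%classic by move=> a Aa; apply: AFG; left.
have FG : (F `<=` G)%classic by move=> a Fa; apply: AFG; right.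
apply/seteqP; split=> // a Ga; left; apply: contrapT => nAa.
apply: (maxA G); last by rewrite /= (setUidPl _ _).2.
by split=> // GA; exact/nAa/GA.
Qed.

End Filters.

Section InteriorOperators.
Context (d : Order.disp_t) (B : ctbDistrLatticeType d) (i : B -> B).
Hypothesis intr_i : interior_operator i.

Lemma interior_mono a b : a <= b -> i a <= i b.
Proof. by have [iI _ _ _] := intr_i; rewrite !leEmeet -iI => /eqP ->. Qed.

Lemma interior_idem a : i (i a) = i a.
Proof. by have [_ _ ile iid] := intr_i; apply/le_anti; rewrite ile iid. Qed.

Lemma meet_closed_interior_fixed (F : set B) : lattice_filter F ->
  meet_closed (F `&` [set a | i a = a])%classic.
Proof.
have [iI i1 _ _] := intr_i => -[F1 FI _]; split=> [//|a b [Fa ia] [Fb ib]].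
by split; [exact: FI|rewrite /= iI ia ib].
Qed.

End InteriorOperators.

Section CanonicalFrameMS4.
Context (d : Order.disp_t) (A : bimodal_algebra d).
Hypothesis hA : MS4_algebra A.
Local Notation box := (@alg_box d A).
Local Notation all := (@alg_forall d A).

Lemma forall_fixed_compl (a : A) : all a = a -> all (~` a) = ~` a.
Proof.
have [_ [_ _ all_le _] le_all_ex _] := hA => aE.
apply/le_anti; rewrite all_le /=.
by have := le_all_ex (~` a); rewrite /alg_exists complK aE.
Qed.

(** It suffices to transfer forall-fixed elements in one direction, since
    these form a set closed under complement. *)
Lemma canonical_E_sub (x y : ultrafilters A) :
  (sval x `&` [set a | all a = a] `<=` sval y)%classic -> canonical_E x y.
Proof.
case: x y => [x ux] [y uy] /= xy; apply/seteqP.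
split=> a [xa aE]; split=> //; first exact: xy.
apply: contrapT => /(ultrafilter_compl a ux) xna.
have : y (~` a) by apply: xy; split=> //; exact: forall_fixed_compl.
by move=> /(ultrafilter_compl a uy).
Qed.

Lemma canonical_frame_commute (x y z : ultrafilters A) :
  canonical_E x y -> canonical_R y z ->
  exists2 w, canonical_R x w & canonical_E w z.
Proof.
move=> xEy yRz; have [ibox iall _ box_all] := hA.
have [_ _ box_le _] := ibox; have [_ _ all_le _] := iall.
have [[[fx _] _] [[fy _] _] uz] := And3 (svalP x) (svalP y) (svalP z).
have [[fz _] _] := uz.
have [[_ _ xle] [_ _ yle] [_ _ zle]] := And3 fx fy fz.
have mS := meet_closed_interior_fixed ibox fx.
have mT := meet_closed_interior_fixed iall fz.
have [|w uw subw] := ultrafilter_extension (filter_join_proper mS mT _).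
  move=> h b [xh hE] [zb bE] h_nb.
  have nbE := forall_fixed_compl bE.
  have : (sval x `&` [set a | all a = a])%classic (all (box (~` b))).
    split; last exact: interior_idem.
    apply: xle xh; rewrite -[h]hE (le_trans (interior_mono ibox h_nb)) //.
    by rewrite -{1}nbE.
  rewrite xEy => -[yc _].
  have zbox : sval z (box (~` b)).
    apply: yRz; split; last exact: interior_idem.
    exact: yle (all_le _) yc.
  by have /(ultrafilter_compl b uz) := zle _ _ (box_le _) zbox.
exists (exist _ w uw).
  by move=> a xa; apply: subw; exact: filter_join_subl.
apply/esym/canonical_E_sub => a za.
by apply: subw; exact: filter_join_subr.
Qed.

End CanonicalFrameMS4.

Section ComplexAlgebraMS4.
Context (F : frame).
Local Open Scope classical_set_scope.

Lemma frame_boxE (U : set F) :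
  frame_box U = [set x | forall y, frame_R x y -> U y].
Proof.
apply/seteqP; split=> x /= Ux; last by move=> [y nUy /Ux].
by move=> y xy; apply: contrapT => nUy; apply: Ux; exists y.
Qed.

Lemma frame_forallE (U : set F) :
  frame_forall U = [set x | forall y, frame_E x y -> U y].
Proof.
have [_ symE _] := frame_E_equivalence F.
apply/seteqP; split=> x /= Ux; last by move=> [y nUy /symE /Ux].
by move=> y xy; apply: contrapT => nUy; apply: Ux; exists y => //; exact: symE.
Qed.

(** The interior operator of the Alexandrov topology of a preorder. *)
Lemma interior_operator_preorder (X : Type) (R : X -> X -> Prop)
    (i : set X -> set X) :
  RelationClasses.PreOrder R ->
  (forall U, i U = [set x | forall y, R x y -> U y]) -> interior_operator i.
Proof.
move=> [Rxx Rtr] iE; split.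
- move=> U V; rewrite !meetEset !iE; apply/seteqP; split=> x /=.
    by move=> UV; split=> y /UV[].
  by move=> [Ux Vx] y xy; split; [exact: Ux|exact: Vx].
- by rewrite iE topEset; apply/seteqP; split.
- by move=> U; rewrite iE; apply/subsetPset => x; apply.
- move=> U; rewrite !iE; apply/subsetPset => x /= Ux y xy z yz.
  by apply: Ux; exact: Rtr yz.
Qed.

Lemma MS4_complex_algebra :
  (forall x y z : F, frame_E x y -> frame_R y z ->
     exists2 w, frame_R x w & frame_E w z) ->
  MS4_algebra (complex_algebra F).
Proof.
move=> ER; have [Exx symE trE] := frame_E_equivalence F.
split.
- exact: interior_operator_preorder (frame_R_preorder F) frame_boxE.
- by apply: interior_operator_preorder frame_forallE; split.
- move=> U; apply/subsetPset; rewrite /alg_exists /= !complEset.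
  rewrite !frame_forallE => x Ux y xy /(_ x); apply=> //.
  exact: symE.
- move=> U; apply/subsetPset; rewrite /= !frame_boxE !frame_forallE.
  move=> x /= Ux y xy z yz; have [w xw wz] := ER _ _ _ xy yz.
  exact: Ux wz.
Qed.

End ComplexAlgebraMS4.

Theorem corollary2p27 (d : Order.disp_t) (B : bimodal_algebra d)
  (hB : MS4_algebra B) : MS4_algebra (complex_algebra (canonical_frame B)).
Proof. exact/MS4_complex_algebra/canonical_frame_commute. Qed.
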